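(* Let $\vec v_0,\dots,\vec v_{k-1},\vec c\in\mathbb{R}^n$ and let $A=\{\sum_{i}\alpha_i\vec v_i+\vec c : |\alpha_i|\le 1 \text{ for all } i\}$ be the affine region they generate. For each tie class $j$ of $A$ and each $i$, let $\vec{v'^j_i}$ be the vector obtained from $\vec v_i$ by setting to $0$ every component whose index is not in tie class $j$. Then for every $\vec x=\sum_i\alpha_i\vec v_i+\vec c$ with $|\alpha_i|\le 1$ for all $i$, there are scalars $\alpha'^j_i$ such that 1. $\mathit{Relu}(\vec x)=\sum_{i,j}\alpha'^j_i\,\vec{v'^j_i}+\mathit{Relu}(\vec c)$, and 2. $|\alpha'^j_i|\le 1$ for all $i$ and $j$. In particular, the affine region with basis vectors $\{\vec{v'^j_i}\}$ and center $\mathit{Relu}(\vec c)$ contains the image of $A$ under $\mathit{Relu}$.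
   Context: $\mathit{Relu}$ acts componentwise: $\mathit{Relu}(\vec x)_l=\max(x_l,0)$. An affine region with basis vectors $\vec w_1,\dots,\vec w_m$ and center $\vec d$ is the set $\{\sum_i\gamma_i\vec w_i+\vec d : |\gamma_i|\le 1\}$. Given the affine region $A$, two indices $i_1,i_2\in\{0,\dots,n-1\}$ are called tied iff for every vector $\vec x\in A$ the components of $\vec x$ at $i_1$ and $i_2$ have the same sign. The paper takes ''tied'' to be an equivalence relation on the index set; its equivalence classes are the tie classes of $A$. *)

(* Defs.v *)
From mathcomp Require Import all_boot all_order all_algebra.
From mathcomp Require Import boolp classical_sets reals.

Set Implicit Arguments.
Unset Strict Implicit.
Unset Printing Implicit Defensive.

Import Order.TTheory GRing.Theory Num.Theory.
Local Open Scope classical_set_scope.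
Local Open Scope ring_scope.

Definition relu (R : realType) (n : nat) (x : 'rV[R]_n) : 'rV[R]_n :=
  \row_l Num.max (x 0 l) 0.

Definition affine_region (R : realType) (n : nat) (I : finType)
    (w : I -> 'rV[R]_n) (d : 'rV[R]_n) : set 'rV[R]_n :=
  [set x | exists2 gamma : I -> R,
     (forall i, `|gamma i| <= 1) & x = \sum_i gamma i *: w i + d].

(* Signs are three-valued (-1, 0 or 1): a zero component has the same sign only
   as another zero component. This makes "tied" an equivalence relation, which
   the condition [0 <= x 0 i1 * x 0 i2] would not. *)
Definition tied (R : realType) (n : nat) (A : set 'rV[R]_n) : rel 'I_n :=
  fun i1 i2 => `[< forall x, A x -> Num.sg (x 0 i1) = Num.sg (x 0 i2) >].

Lemma tied_equiv (R : realType) (n : nat) (A : set 'rV[R]_n) :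
  equivalence_rel (tied A).
Proof.
move=> i1 i2 i3; split; first exact/asboolP.
move=> /asboolP h12; apply/asboolP/asboolP => h x Ax.
  by rewrite -h12 // h.
by rewrite h12 // h.
Qed.

Definition tie_classes (R : realType) (n : nat) (A : set 'rV[R]_n) :
    {set {set 'I_n}} :=
  equivalence_partition (tied A) [set: 'I_n]%SET.

Definition tie_class (R : realType) (n : nat) (A : set 'rV[R]_n) : finType :=
  {J : {set 'I_n} | J \in tie_classes A}.

Definition restrict_to (R : realType) (n : nat) (J : {set 'I_n})
    (u : 'rV[R]_n) : 'rV[R]_n :=
  \row_l (if l \in J then u 0 l else 0).

(* Main.v *)
(* On a tie class all components of the segment from c to x vanish at the same
   parameter, so there Relu(x) - Relu(c) = b (x - c) with one common factor
   b in [0, 1], and alpha'^j_i = b_j alpha_i works. *)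
Require Import Defs.
From mathcomp Require Import all_boot all_order all_algebra.
From mathcomp Require Import boolp classical_sets reals.
From mathcomp Require Import lra.

Set Implicit Arguments.
Unset Strict Implicit.
Unset Printing Implicit Defensive.

Import Order.TTheory GRing.Theory Num.Theory.
Local Open Scope classical_set_scope.
Local Open Scope ring_scope.

(** The region is star-shaped about [d], since multiplying all coefficients by [t] keeps them in
    [-1, 1]. Tiedness can therefore be used at every point between [d] and [x], not only at the two
    ends. *)
Lemma affine_region_segment (R : realType) (n : nat) (I : finType)
    (w : I -> 'rV[R]_n) (d x : 'rV[R]_n) (t : R) :
  affine_region w d x -> 0 <= t <= 1 ->
  affine_region w d (t *: (x - d) + d).
Proof.
move=> [g g1 ->] /andP[t0 t1]; exists (fun i => t * g i) => [i|].
  by rewrite normrM ger0_norm // mulr_ile1.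
by rewrite addrK scaler_sumr; under eq_bigr do rewrite scalerA.
Qed.

Lemma tied_relu_factor (R : realType) (n : nat) (I : finType)
    (w : I -> 'rV[R]_n) (d x : 'rV[R]_n) (l0 : 'I_n) :
  affine_region w d x ->
  exists2 b : R, 0 <= b <= 1 &
    forall l, tied (affine_region w d) l0 l ->
      relu x 0 l = b * (x 0 l - d 0 l) + relu d 0 l.
Proof.
move=> Ax.
have sgE (t : R) l : 0 <= t <= 1 -> tied (affine_region w d) l0 l ->
    Num.sg (t * (x 0 l0 - d 0 l0) + d 0 l0)
      = Num.sg (t * (x 0 l - d 0 l) + d 0 l).
  move=> t01 /asboolP/(_ _ (affine_region_segment Ax t01)).
  by rewrite !mxE.
have sgd l : tied (affine_region w d) l0 l -> Num.sg (d 0 l0) = Num.sg (d 0 l).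
  by move=> /(sgE 0); rewrite !mul0r !add0r lexx ler01; apply.
have sgx l : tied (affine_region w d) l0 l -> Num.sg (x 0 l0) = Num.sg (x 0 l).
  by move=> /asboolP/(_ _ Ax).
have ge0E (y : 'rV[R]_n) l : Num.sg (y 0 l0) = Num.sg (y 0 l) ->
    (0 <= y 0 l0) = (0 <= y 0 l) by rewrite -sgr_ge0 => ->; rewrite sgr_ge0.
(* The signs at [l0] decide the case for the whole class. Without a sign change [b] is 1 or 0;
   otherwise it comes from the zero crossing. *)
have [x0|x0] := leP 0 (x 0 l0); have [d0|d0] := leP 0 (d 0 l0).
- exists 1 => [|l tl]; first by rewrite ler01 lexx.
  have xl : 0 <= x 0 l by rewrite -(ge0E _ _ (sgx l tl)).
  have dl : 0 <= d 0 l by rewrite -(ge0E _ _ (sgd l tl)).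
  by rewrite !mxE !max_l // mul1r subrK.
- have p : x 0 l0 - d 0 l0 != 0 by rewrite gt_eqF //; lra.
  have [t t01 t0] : exists2 t : R, 0 <= t <= 1 &
      t * (x 0 l0 - d 0 l0) + d 0 l0 = 0.
    exists (- d 0 l0 / (x 0 l0 - d 0 l0)); last by rewrite divfK // addNr.
    by rewrite divr_ge0 ?ler_pdivrMr //=; lra.
  (* Only the part of the segment after the crossing counts: where t (x_l - d_l) + d_l = 0, one has
     (1 - t) (x_l - d_l) = x_l. *)
  exists (1 - t) => [|l tl]; first by lra.
  have xl : 0 <= x 0 l by rewrite -(ge0E _ _ (sgx l tl)).
  have dl : d 0 l < 0 by rewrite ltNge -(ge0E _ _ (sgd l tl)) -ltNge.
  (* Signs are three-valued, so a zero at [l0] forces a zero at [l] for the same [t]. *)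
  have /esym/eqP := sgE t l t01 tl; rewrite t0 sgr0 sgr_eq0 => /eqP tE.
  by rewrite !mxE max_l // max_r ?ltW //; lra.
- have p : d 0 l0 - x 0 l0 != 0 by rewrite gt_eqF //; lra.
  have [t t01 t0] : exists2 t : R, 0 <= t <= 1 &
      t * (x 0 l0 - d 0 l0) + d 0 l0 = 0.
    exists (d 0 l0 / (d 0 l0 - x 0 l0)).
      by rewrite divr_ge0 ?ler_pdivrMr //=; lra.
    by rewrite -[x 0 l0 - _]opprB mulrN divfK // addNr.
  (* Here only the part before the crossing counts: t (x_l - d_l) = - d_l cancels Relu(d)_l =
     d_l. *)
  exists t => // l tl.
  have xl : x 0 l < 0 by rewrite ltNge -(ge0E _ _ (sgx l tl)) -ltNge.
  have dl : 0 <= d 0 l by rewrite -(ge0E _ _ (sgd l tl)).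
  have /esym/eqP := sgE t l t01 tl; rewrite t0 sgr0 sgr_eq0 => /eqP tE.
  by rewrite !mxE max_r ?ltW // max_l //; lra.
- exists 0 => [|l tl]; first by rewrite ler01 lexx.
  have xl : x 0 l < 0 by rewrite ltNge -(ge0E _ _ (sgx l tl)) -ltNge.
  have dl : d 0 l < 0 by rewrite ltNge -(ge0E _ _ (sgd l tl)) -ltNge.
  by rewrite !mxE !max_r ?ltW // mul0r add0r.
Qed.

Lemma tie_class_tied (R : realType) (n : nat) (A : set 'rV[R]_n)
    (j : tie_class A) :
  exists l0, val j = [set l | tied A l0 l]%SET.
Proof.
by case: j => J /= /imsetP[l0 _ ->]; exists l0; apply/setP=> l; rewrite !inE.
Qed.

(** The tie classes partition the indices, so at coordinate [l] every summand vanishes except the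
    one of the class containing [l]. That class is chosen before [b] and [u], so one [j] serves all
    the vectors [v i]. *)
Lemma sum_tie_class_restrict (R : realType) (n : nat) (A : set 'rV[R]_n)
    (l : 'I_n) :
  exists2 j : tie_class A, l \in val j &
    forall (b : tie_class A -> R) (u : 'rV[R]_n),
      (\sum_i b i *: restrict_to (val i) u) 0 l = b j * u 0 l.
Proof.
have eqA : {in [set: 'I_n]%SET & &, equivalence_rel (tied A)}.
  by move=> i1 i2 i3 _ _ _; apply: tied_equiv.
have /and3P[/eqP covA trivA _] := equivalence_partitionP eqA.
have lcov : l \in finset.cover (tie_classes A) by rewrite covA inE.
exists (Sub (finset.pblock (tie_classes A) l) (finset.pblock_mem lcov)) => [|b u].
  by rewrite finset.mem_pblock.
set j := Sub _ _; rewrite summxE (bigD1 j) //= big1 ?addr0 => [|i ij].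
  by rewrite !mxE finset.mem_pblock lcov.
rewrite !mxE ifN ?mulr0 //; apply: contra ij => li; apply/eqP/val_inj.
by rewrite /= (finset.def_pblock trivA (valP i) li).
Qed.

Theorem theorem1 (R : realType) (n k : nat)
    (v : 'I_k -> 'rV[R]_n) (c : 'rV[R]_n) :
  let A := affine_region v c in
  (forall (x : 'rV[R]_n) (alpha : 'I_k -> R),
     x = \sum_i alpha i *: v i + c ->
     (forall i, `|alpha i| <= 1) ->
     exists alpha' : 'I_k -> tie_class A -> R,
       relu x = \sum_i \sum_j alpha' i j *: restrict_to (val j) (v i) + relu c
       /\ (forall i j, `|alpha' i j| <= 1))
  /\ [set relu x | x in A] `<=`
     affine_region
       (fun ij : 'I_k * tie_class A => restrict_to (val ij.2) (v ij.1))
       (relu c).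
Proof.
move=> A.
have coeffs x (alpha : 'I_k -> R) : x = \sum_i alpha i *: v i + c ->
    (forall i, `|alpha i| <= 1) ->
    exists alpha' : 'I_k -> tie_class A -> R,
      relu x = \sum_i \sum_j alpha' i j *: restrict_to (val j) (v i) + relu c
      /\ (forall i j, `|alpha' i j| <= 1).
  move=> xE alpha1.
  have Ax : A x by exists alpha.
  (* The factor depends on the class and on [x], but not on the basis vector. *)
  have /choice[b bP] (j : tie_class A) : exists b : R, 0 <= b <= 1 /\
      forall l, l \in val j -> relu x 0 l = b * (x 0 l - c 0 l) + relu c 0 l.
    have [l0 ->] := tie_class_tied j.
    have [b b01 bE] := tied_relu_factor l0 Ax.
    by exists b; split=> // l; rewrite inE => /bE.
  exists (fun i j => b j * alpha i); split=> [|i j]; last first.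
    have [/andP[b0 b1] _] := bP j.
    by rewrite normrM ger0_norm // mulr_ile1.
  apply/rowP => l; rewrite [RHS]mxE.
  have [j lj sumE] := sum_tie_class_restrict A l.
  have [_ ->//] := bP j; congr (_ + _).
  have -> : x 0 l - c 0 l = \sum_i alpha i * v i 0 l.
    by rewrite xE mxE addrK summxE; under eq_bigr do rewrite mxE.
  rewrite summxE mulr_sumr; apply: eq_bigr => i _.
  by rewrite (sumE (fun j => b j * alpha i)) mulrA.
split=> // _ [x [alpha alpha1 xE] <-].
have [alpha' [-> alpha'1]] := coeffs _ _ xE alpha1.
exists (fun ij => alpha' ij.1 ij.2) => [ij|]; first exact: alpha'1.
(* The region is indexed by pairs, so the iterated sum becomes a single one. *)
by rewrite pair_bigA.
Qed.
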